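(* Let $A$ be a Banach algebra, $B$ a Banach $A$-bimodule, $n\ge 0$ an even integer, and $D:A^{(n)}\to B^{(n+1)}$ a derivation. If $\tilde Z^\ell_{A^{(n+2)}}(B^{(n+2)})=B^{(n+2)}$, then $D'':A^{(n+2)}\to B^{(n+3)}$ is a derivation.
   Context: $X^{(0)}=X$ and $X^{(k)}$ is the dual of $X^{(k-1)}$. For a bounded bilinear map $m:X\times Y\to Z$ define $m^*:Z^*\times X\to Y^*$, $m^{**}:Y^{**}\times Z^*\to X^*$, $m^{***}:X^{**}\times Y^{**}\to Z^{**}$ by $\langle m^*(z',x),y\rangle=\langle z',m(x,y)\rangle$, $\langle m^{**}(y'',z'),x\rangle=\langle y'',m^*(z',x)\rangle$, $\langle m^{***}(x'',y''),z'\rangle=\langle x'',m^{**}(y'',z')\rangle$. For even $k$, $A^{(k)}$ is a Banach algebra and $B^{(k)}$ a Banach $A^{(k)}$-bimodule, inductively: passing from $k$ to $k+2$, the product of $A^{(k)}$ and the left and right module actions $A^{(k)}\times B^{(k)}\to B^{(k)}$, $B^{(k)}\times A^{(k)}\to B^{(k)}$ are replaced by their extensions $m^{***}$ (the first Arens product and corresponding module actions); all are written by juxtaposition. For even $k$, $B^{(k+1)}$ is the dual $A^{(k)}$-bimodule of $B^{(k)}$: $\langle fa,b\rangle=\langle f,ab\rangle$, $\langle af,b\rangle=\langle f,ba\rangle$ for $f\in B^{(k+1)}$, $a\in A^{(k)}$, $b\in B^{(k)}$. For even $k\ge2$, $\tilde Z^\ell_{A^{(k)}}(B^{(k)})$ is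 the set of $b\in B^{(k)}$ such that $a\mapsto ba$ is continuous from $A^{(k)}$ with the weak$^*$ topology $\sigma(A^{(k)},A^{(k-1)})$ to $B^{(k)}$ with the weak topology $\sigma(B^{(k)},B^{(k+1)})$. A derivation from a Banach algebra $C$ into a Banach $C$-bimodule $X$ is a bounded linear map $D$ with $D(xy)=xD(y)+D(x)y$. $D''$ denotes the second adjoint of $D$. *)

(* Defs.v *)
From HB Require Import structures.
From mathcomp Require Import all_boot all_order all_algebra.
From mathcomp Require Import complex.
From mathcomp Require Import all_classical all_reals all_analysis.

Set Implicit Arguments.
Unset Strict Implicit.
Unset Printing Implicit Defensive.

Import Order.TTheory GRing.Theory Num.Def Num.Theory.
Import numFieldNormedType.Exports.

Local Open Scope classical_set_scope.
Local Open Scope ring_scope.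

Inductive scalar_kind := RealScalars | ComplexScalars.

Definition scalars (R : realType) (k : scalar_kind) : numFieldType :=
  match k with
  | RealScalars => R
  | ComplexScalars => R[i]
  end.

Section ScalarSup.
Variables (R : realType) (k : scalar_kind).
Local Notation K := (scalars R k).

Lemma scalars_supremums (E : set K) (M : K) :
  E !=set0 -> (forall x, E x -> 0 <= x) -> ubound E M -> supremums E !=set0.
Proof.
case: k E M => /= E M [x Ex] E0 EM.
  have hE : has_sup E by split; [exists x|exists M].
  exists (sup E); split; first by move=> y Ey; exact: sup_upper_bound.
  by move=> y /= yE; apply: ge_sup => //; exists x.
have real_of (z : R[i]) : 0 <= z -> z = (complex.Re z)%:C%C.
  by case: z => a b; rewrite lecE /= => /andP[/eqP -> _].
pose E' : set R := [set complex.Re y | y in E].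
have hE : has_sup E'.
  split; first by exists (complex.Re x), x.
  exists (complex.Re M) => _ [y Ey <-].
  by move: (EM _ Ey); rewrite lecE => /andP[].
exists ((sup E')%:C)%C; split.
  move=> y Ey; rewrite (real_of _ (E0 _ Ey)) lecR.
  by apply: sup_upper_bound => //; exists y.
move=> y /= yE.
have y0 : 0 <= y := le_trans (E0 _ Ex) (yE _ Ex).
rewrite (real_of _ y0) lecR; apply: ge_sup; first by exists (complex.Re x), x.
by move=> _ [z Ez <-]; move: (yE _ Ez); rewrite lecE => /andP[].
Qed.

End ScalarSup.

Section BoundedLinear.
Variables (R : realType) (k : scalar_kind).
Local Notation K := (scalars R k).
Variables X Y : normedModType K.

Definition bounded_linear (f : X -> Y) : Prop :=
  linear f /\ exists M : K, forall x, `|f x| <= M * `|x|.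

Definition bounded_linear_pred : {pred X -> Y} :=
  [pred f | `[< bounded_linear f >]].

Record blin := BLin {
  blin_fun :> X -> Y;
  blin_subproof : blin_fun \in bounded_linear_pred
}.

HB.instance Definition _ := [isSub for blin_fun].
HB.instance Definition _ := [Choice of blin by <:].

Lemma blinP (f : blin) : bounded_linear f.
Proof. by case: f => f hf /=; apply/asboolP. Qed.

Definition mk_blin (f : X -> Y) (hf : bounded_linear f) : blin :=
  BLin (asboolT hf : f \in bounded_linear_pred).

Lemma bounded_linear_submod : submod_closed bounded_linear_pred.
Proof.
split.
  apply/asboolP; split; first by move=> a x y; rewrite /= scaler0 addr0.
  by exists 0 => x; rewrite /= normr0 mul0r.
move=> a f g /asboolP[fl [M fM]] /asboolP[gl [N gN]].
apply/asboolP; split.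
  move=> b x y; rewrite !fctE fl gl !scalerDr !scalerA (mulrC a b).
  by rewrite -!addrA; congr (_ + _); rewrite addrCA.
exists (`|a| * M + N) => x; rewrite !fctE mulrDl -mulrA.
rewrite (le_trans (ler_normD _ _))// lerD// normrZ.
by rewrite ler_wpM2l.
Qed.

HB.instance Definition _ := GRing.isSubmodClosed.Build _ _ bounded_linear_pred
  bounded_linear_submod.
HB.instance Definition _ := [SubChoice_isSubLmodule of blin by <:].

(* The norm of a normedModType over K is K-valued, so the supremum is taken for
   the order of K; it exists by scalars_supremums. *)
Definition opnorm (f : blin) : K :=
  supremum 0 [set `|f x| | x in [set x : X | `|x| <= 1]].

Local Notation unit_values f := [set `|f x| | x in [set x : X | `|x| <= 1]].

Lemma blin0 (f : blin) : f 0 = 0.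
Proof.
have [fl _] := blinP f; have := fl 1 0 0.
by rewrite !scale1r addr0 => /(congr1 (fun z => z - f 0)); rewrite subrr addrK.
Qed.

Lemma blinZ (f : blin) a x : f (a *: x) = a *: f x.
Proof. by have [fl _] := blinP f; have := fl a x 0; rewrite blin0 !addr0. Qed.

Lemma opnorm_sup (f : blin) : supremums (unit_values f) (opnorm f).
Proof.
have neq0 : unit_values f !=set0.
  by exists `|f 0|, 0 => //=; rewrite normr0.
have : supremums (unit_values f) !=set0.
  have [_ [M fM]] := blinP f.
  apply: (@scalars_supremums _ _ _ `|M|) => //.
    by move=> _ [x _ <-].
  move=> _ [x /= x1 <-]; apply: le_trans (fM x) _.
  have [->|x0] := eqVneq x 0; first by rewrite normr0 mulr0.
  have nx : 0 < `|x| by rewrite normr_gt0.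
  have M0 : 0 <= M by rewrite -(pmulr_lge0 _ nx) (le_trans _ (fM x)).
  by rewrite ger0_norm// ler_piMr.
case=> s hs; rewrite /opnorm /supremum ifF; last exact/negbTE/set0P.
by case: xgetP => [y _ //|/(_ s)].
Qed.

Lemma opnormP (f : blin) x : `|f x| <= opnorm f * `|x|.
Proof.
have [ub _] := opnorm_sup f.
have [->|x0] := eqVneq x 0; first by rewrite blin0 !normr0 mulr0.
have nx : 0 < `|x| by rewrite normr_gt0.
rewrite -ler_pdivrMr// mulrC -[`|x|^-1]ger0_norm ?invr_ge0// -normrZ -blinZ.
by apply: ub; exists (`|x|^-1 *: x) => //=; rewrite normfZV.
Qed.

Lemma opnorm_le (f : blin) (M : K) :
  0 <= M -> (forall x, `|f x| <= M * `|x|) -> opnorm f <= M.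
Proof.
move=> M0 fM; have [_] := opnorm_sup f; apply => _ [x /= x1 <-].
by rewrite (le_trans (fM x))// ler_piMr.
Qed.

Lemma opnorm_ge0 (f : blin) : 0 <= opnorm f.
Proof.
have [ub _] := opnorm_sup f; apply: le_trans (ub `|f 0| _) => //.
by exists 0 => //=; rewrite normr0.
Qed.

Lemma opnormD (f g : blin) : opnorm (f + g) <= opnorm f + opnorm g.
Proof.
apply: opnorm_le; first by rewrite addr_ge0// opnorm_ge0.
move=> x; rewrite mulrDl (le_trans (ler_normD _ _))//.
by apply: lerD; exact: opnormP.
Qed.

Lemma opnormZ (a : K) (f : blin) : opnorm (a *: f) = `|a| * opnorm f.
Proof.
have le_opnormZ b (g : blin) : opnorm (b *: g) <= `|b| * opnorm g.
  apply: opnorm_le; first by rewrite mulr_ge0// opnorm_ge0.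
  by move=> x; rewrite [X in `|X|](_ : _ = b *: g x)// normrZ -mulrA ler_wpM2l// opnormP.
apply/eqP; rewrite eq_le le_opnormZ/=.
have [->|a0] := eqVneq a 0; first by rewrite normr0 mul0r opnorm_ge0.
rewrite -ler_pdivlMl ?normr_gt0//.
have := le_opnormZ a^-1 (a *: f).
by rewrite scalerA mulVf// scale1r normfV.
Qed.

Lemma opnorm_eq0 (f : blin) : opnorm f = 0 -> f = 0.
Proof.
move=> f0; apply/val_inj/funext => x /=; apply/eqP; rewrite -normr_le0.
by rewrite (le_trans (opnormP f x))// f0 mul0r.
Qed.

HB.instance Definition _ :=
  Lmodule_isNormed.Build K blin opnormD opnormZ opnorm_eq0.

End BoundedLinear.


Section BoundedBilinear.
Variables (R : realType) (k : scalar_kind).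
Local Notation K := (scalars R k).

Record bbilin (X Y Z : normedModType K) := BBilin {
  bbilin_fun :> X -> Y -> Z;
  bbilin_linearl : forall y, linear (bbilin_fun ^~ y);
  bbilin_linearr : forall x, linear (bbilin_fun x);
  bbilin_bounded : exists M : K,
    forall x y, `|bbilin_fun x y| <= M * `|x| * `|y|
}.

Lemma bbilin_bounded_ge0 (X Y Z : normedModType K) (m : bbilin X Y Z) :
  exists2 M : K, 0 <= M & forall x y, `|m x y| <= M * `|x| * `|y|.
Proof.
have [M mM] := bbilin_bounded m; exists `|M| => // x y.
have [->|x0] := eqVneq x 0.
  by have := mM 0 y; rewrite !normr0 !mulr0.
have [->|y0] := eqVneq y 0.
  by have := mM x 0; rewrite !normr0 !mulr0.
rewrite (le_trans (mM x y))// -!mulrA ler_wpM2r// ?mulr_ge0//.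
have xy0 : 0 < `|x| * `|y| by rewrite mulr_gt0// normr_gt0.
by rewrite ger0_norm// -(pmulr_lge0 _ xy0) mulrA (le_trans _ (mM x y)).
Qed.

Definition dual (X : normedModType K) : normedModType K := blin X K^o.

Section Operations.
Variables X Y Z : normedModType K.

Lemma bbilin0_linearl (y : Y) : linear (fun _ : X => 0 : Z).
Proof. by move=> a x x'; rewrite scaler0 addr0. Qed.

Lemma bbilin0_linearr (x : X) : linear (fun _ : Y => 0 : Z).
Proof. by move=> a y y'; rewrite scaler0 addr0. Qed.

Lemma bbilin0_bounded : exists M : K,
  forall (x : X) (y : Y), `|0 : Z| <= M * `|x| * `|y|.
Proof. by exists 0 => x y; rewrite normr0 !mul0r. Qed.

Definition bbilin0 : bbilin X Y Z :=
  @BBilin X Y Z (fun _ _ => 0) bbilin0_linearl bbilin0_linearr bbilin0_bounded.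

Variable m : bbilin X Y Z.

Lemma flip_bounded : exists M : K, forall y x, `|m x y| <= M * `|y| * `|x|.
Proof.
have [M mM] := bbilin_bounded m; exists M => y x.
by rewrite -mulrA (mulrC `|y|) mulrA.
Qed.

Definition flip : bbilin Y X Z :=
  @BBilin Y X Z (fun y x => m x y) (bbilin_linearr m) (bbilin_linearl m)
    flip_bounded.

Lemma star_app_bounded_linear (z' : dual Z) (x : X) :
  bounded_linear (fun y => z' (m x y) : K^o).
Proof.
have [zl _] := blinP z'; split.
  by move=> a y y'; rewrite bbilin_linearr zl.
have [M M0 mM] := bbilin_bounded_ge0 m.
exists (opnorm z' * (M * `|x|)) => y.
rewrite (le_trans (opnormP _ _))// -mulrA ler_wpM2l ?opnorm_ge0//.
Qed.

Definition star_app (z' : dual Z) (x : X) : dual Y :=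
  mk_blin (star_app_bounded_linear z' x).

Lemma star_linearl (x : X) : linear (star_app ^~ x).
Proof. by move=> a f g; apply/val_inj/funext. Qed.

Lemma star_linearr (z' : dual Z) : linear (star_app z').
Proof.
move=> a x x'; apply/val_inj/funext => y /=.
by have [zl _] := blinP z'; rewrite bbilin_linearl zl.
Qed.

Lemma star_bounded : exists M : K,
  forall z' x, `|star_app z' x| <= M * `|z'| * `|x|.
Proof.
have [M M0 mM] := bbilin_bounded_ge0 m; exists M => z' x.
apply: opnorm_le; first by rewrite !mulr_ge0.
move=> y; apply: le_trans (opnormP z' (m x y)) _.
have -> : M * `|z'| * `|x| * `|y| = `|z'| * (M * `|x| * `|y|).
  by rewrite -!mulrA mulrCA.
by apply: ler_wpM2l; [exact: opnorm_ge0|exact: mM].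
Qed.

(* The map m^* : Z^* x X -> Y^*, <m^*(z', x), y> = <z', m(x, y)>. *)
Definition star : bbilin (dual Z) X (dual Y) :=
  BBilin star_linearl star_linearr star_bounded.

End Operations.

(* The third adjoint m^*** : X^** x Y^** -> Z^**. *)
Definition arens (X Y Z : normedModType K) (m : bbilin X Y Z) :
    bbilin (dual (dual X)) (dual (dual Y)) (dual (dual Z)) :=
  star (star (star m)).

Section Adjoint.
Variables (X Y : normedModType K) (D : blin X Y).

Lemma adjoint_app_bounded_linear (g : dual Y) :
  bounded_linear (fun x => g (D x) : K^o).
Proof.
have [Dl _] := blinP D; have [gl _] := blinP g; split.
  by move=> a x x'; rewrite Dl gl.
exists (opnorm g * opnorm D) => x.
rewrite (le_trans (opnormP _ _))// -mulrA ler_wpM2l ?opnorm_ge0//.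
exact: opnormP.
Qed.

Definition adjoint_app (g : dual Y) : dual X :=
  mk_blin (adjoint_app_bounded_linear g).

Lemma adjoint_bounded_linear : bounded_linear adjoint_app.
Proof.
split; first by move=> a f g; apply/val_inj/funext.
exists (opnorm D) => g.
apply: opnorm_le; first by rewrite mulr_ge0 ?opnorm_ge0.
move=> x; apply: le_trans (opnormP g (D x)) _; rewrite (mulrC (opnorm D)) -mulrA.
by apply: ler_wpM2l; [exact: opnorm_ge0|exact: opnormP].
Qed.

Definition adjoint : blin (dual Y) (dual X) := mk_blin adjoint_bounded_linear.

End Adjoint.

Fixpoint iterdual (X : normedModType K) (n : nat) : normedModType K :=
  if n is n'.+1 then dual (iterdual X n') else X.

(* The value at odd n is a placeholder: only even iterates are defined. *)
Fixpoint iterarens (X Y Z : normedModType K) (m : bbilin X Y Z) (n : nat) :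
    bbilin (iterdual X n) (iterdual Y n) (iterdual Z n) :=
  match n with
  | 0 => m
  | 1 => bbilin0 _ _ _
  | n'.+2 => arens (iterarens m n')
  end.

(* The coarsest topology on T making every ev i continuous. *)
Definition induced_topology (T : choiceType) (I : Type) (V : topologicalType)
    (ev : I -> T -> V) : topologicalType :=
  sup_topology (fun i => Topological.on (initial_topology (ev i))).

Definition weak (X : normedModType K) : topologicalType :=
  induced_topology (fun (f : dual X) (x : X) => f x : K^o).

Definition weak_star (X : normedModType K) : topologicalType :=
  induced_topology (fun (x : X) (f : dual X) => f x : K^o).

End BoundedBilinear.

Section BanachAlgebras.
Variables (R : realType) (k : scalar_kind).
Local Notation K := (scalars R k).

Record banachAlgebra := BanachAlgebra {
  alg_carrier :> completeNormedModType K;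
  alg_mul : bbilin alg_carrier alg_carrier alg_carrier;
  alg_mulA : forall a b c,
    alg_mul a (alg_mul b c) = alg_mul (alg_mul a b) c;
  alg_norm_mul : forall a b, `|alg_mul a b| <= `|a| * `|b|
}.

Record banachBimodule (A : banachAlgebra) := BanachBimodule {
  bimod_carrier :> completeNormedModType K;
  bimod_l : bbilin A bimod_carrier bimod_carrier;
  bimod_r : bbilin bimod_carrier A bimod_carrier;
  bimod_lA : forall a b x, bimod_l a (bimod_l b x) = bimod_l (alg_mul A a b) x;
  bimod_rA : forall x a b, bimod_r (bimod_r x a) b = bimod_r x (alg_mul A a b);
  bimod_lrA : forall a x b, bimod_l a (bimod_r x b) = bimod_r (bimod_l a x) b
}.

(* Module actions of C on the dual of a C-bimodule N:
   <a f, b> = <f, b a> and <f a, b> = <f, a b>. *)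
Definition dual_l (C N : normedModType K) (r : bbilin N C N) :
  bbilin C (dual N) (dual N) := flip (star (flip r)).

Definition dual_r (C N : normedModType K) (l : bbilin C N N) :
  bbilin (dual N) C (dual N) := star l.

Definition is_derivation (C X : normedModType K) (m : bbilin C C C)
    (l : bbilin C X X) (r : bbilin X C X) (D : blin C X) : Prop :=
  forall x y, D (m x y) = l x (D y) + r (D x) y.

(* a |-> b a is weak-star-to-weak continuous from dual Y to N, for a right
   action r of dual Y on N. *)
Definition tZl (Y N : normedModType K) (r : bbilin N (dual Y) N) : set N :=
  [set b | continuous (r b : weak_star Y -> weak N)].

Section Iterated.
Variables (A : banachAlgebra) (B : banachBimodule A) (n : nat).

Definition alg_mul_iter :
    bbilin (iterdual A n) (iterdual A n) (iterdual A n) :=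
  iterarens (alg_mul A) n.

Definition bimod_l_iter :
    bbilin (iterdual A n) (iterdual B n) (iterdual B n) :=
  iterarens (bimod_l B) n.

Definition bimod_r_iter :
    bbilin (iterdual B n) (iterdual A n) (iterdual B n) :=
  iterarens (bimod_r B) n.

Definition is_derivation_iter (D : blin (iterdual A n) (iterdual B n.+1)) :
    Prop :=
  is_derivation alg_mul_iter (dual_l bimod_r_iter) (dual_r bimod_l_iter) D.

End Iterated.

(* This is the set associated with B^(n+2): the index is shifted by 2 so that
   A^(n+2) is syntactically a dual space, with predual A^(n+1). *)
Definition tZl_iter (A : banachAlgebra) (B : banachBimodule A) (n : nat) :
    set (iterdual B n.+2) :=
  @tZl (iterdual A n.+1) (iterdual B n.+2) (bimod_r_iter B n.+2).

End BanachAlgebras.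

Arguments alg_mul_iter {R k} A n.
Arguments bimod_l_iter {R k A} B n.
Arguments bimod_r_iter {R k A} B n.
Arguments is_derivation_iter {R k A} B n D.
Arguments tZl_iter {R k A} B n.

(* Main.v *)
Require Import Defs.
From mathcomp Require Import all_boot all_order all_algebra.
From mathcomp Require Import all_classical all_reals all_analysis.

Import Order.TTheory GRing.Theory Num.Theory.
Import numFieldNormedType.Exports.

Local Open Scope classical_set_scope.

(** Write [C], [N] for the algebra and the module, [F] and [G] for elements of
    the bidual of [C], and test the derivation identity against [b] in the
    bidual of [N].  Unfolding the Arens product, the value of [D''(F G)] at [b]
    is [F] applied to [x |-> <G, y |-> <b, D (x y)>>], and the derivation rule
    writes [D (x y)] as [x D(y) + D(x) y] ([star_adjoint_derivation]).

    The summand [D(x) y] yields [<D''(F) G, b>] by unfolding the extended left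
    action: in both expressions [G] is applied before [F].  In the summand
    [x D(y)] the functional [G] is again applied before [F], whereas
    [<F D''(G), b> = <D''(G), b F>] applies them in the opposite order: what is
    obtained is [<F, lambda>] with [lambda x = <D''(G), b x>], and this has to
    be compared with [<D''(G), b F>].

    The assumption on [b] makes [F |-> <D''(G), b F>] weak-star continuous.  A
    weak-star continuous linear functional on a dual space is evaluation at a
    point of the predual ([weak_star_continuous_evaluation]); the predual is
    here the dual of [C], so the point is determined by its values at the
    elements of [C], and it is [lambda] ([weak_star_continuous_bidual]).  This
    replaces the usual interchange of iterated limits along nets in [C]. *)

Section WeakStarFunctionals.
Context {R : realType} {k : scalar_kind}.
Local Notation K := (scalars R k).
Local Open Scope ring_scope.

Implicit Types X Y : normedModType K.

Lemma dual_scaleD {X} a (F G : dual X) (x : X) :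
  (a *: F + G) x = a * F x + G x.
Proof. by []. Qed.

(** Induction on [s]: as long as some [F0] kills the tail of [s] but not its
    head [x], subtracting a multiple of the evaluation at [x] from [phi]
    reduces the number of points. *)
Lemma functional_span_evaluations Y (s : seq Y) (phi : dual Y -> K) :
  (forall a F G, phi (a *: F + G) = a * phi F + phi G) ->
  (forall F : dual Y, (forall y, y \in s -> F y = 0) -> phi F = 0) ->
  exists y : Y, forall F : dual Y, phi F = F y.
Proof.
elim: s phi => [|x s IH] phi phil phis.
  by exists 0 => F; rewrite phis// blin0.
have [sx|] := pselect (forall F : dual Y,
    (forall y, y \in s -> F y = 0) -> F x = 0).
  apply: IH => // F Fs; apply: phis => y; rewrite inE => /orP[/eqP->|].
    exact: sx.
  exact: Fs.
move=> /existsNP[F0 /not_implyP[F0s /eqP F0x]].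
pose c := phi F0 / F0 x.
have [a F G|F Fs|y yP] := IH (fun F => phi F - c * F x).
- by rewrite phil dual_scaleD mulrDr opprD mulrBr addrACA (mulrCA a).
- have : phi (- (F x / F0 x) *: F0 + F) = 0.
    apply: phis => y; rewrite inE dual_scaleD => /orP[/eqP->|ys].
      by rewrite mulNr divfK// addNr.
    by rewrite (F0s _ ys) (Fs _ ys) mulr0 addr0.
  by rewrite phil mulNr addrC mulrAC -[F x * _ / _]mulrA [F x * _]mulrC.
exists (c *: x + y) => F.
have [Fl _] := blinP F; rewrite Fl -yP.
by rewrite [_ *: _](_ : _ = c * F x)// addrC subrK.
Qed.

(** The subsets of [dual Y] containing the annihilator of some finite set form
    a filter that converges to [0] for the weak-star topology, because each
    evaluation vanishes eventually.  So [phi] is less than [1] on some such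
    annihilator, hence zero there by homogeneity. *)
Lemma weak_star_continuous_evaluation Y (phi : dual Y -> K) :
  (forall a F G, phi (a *: F + G) = a * phi F + phi G) ->
  continuous (phi : weak_star Y -> K^o) ->
  exists y : Y, forall F : dual Y, phi F = F y.
Proof.
move=> phil phic.
pose ann (s : seq Y) := [set F : dual Y | forall y, y \in s -> F y = 0].
pose G : set_system (weak_star Y) := filter_from setT ann.
have GF : Filter G.
  apply: filter_from_filter; first by exists [::].
  move=> s t _ _; exists (s ++ t) => // F Fst.
  by split => y ys; apply: Fst; rewrite mem_cat ys ?orbT.
have phi0 : phi 0 = 0.
  by have := phil (-1) 0 0; rewrite scaler0 addr0 mulN1r addNr.
have G0 : G --> ((0 : dual Y) : weak_star Y).
  apply/cvg_sup => y U /= [_ [[V oV <-] V0 VU]].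
  (* V contains the value 0 of the evaluation at y, so U contains the kernel of
     that evaluation. *)
  exists [:: y] => // F Fy; apply: VU.
  have Fy0 : F y = 0 by apply: Fy; rewrite inE.
  by move: V0; rewrite /= Fy0.
have [s _ sP] : G (phi @^-1` ball (phi 0 : K^o) 1).
  by apply: G0; apply: (phic (0 : dual Y)); exact: nbhsx_ballx.
apply: (functional_span_evaluations _ s _ phil) => F Fs.
apply/eqP; apply: contrapT => /negP phiF.
have : ball (phi 0 : K^o) 1 (phi ((phi F)^-1 *: F + 0)).
  by apply: sP => y ys; rewrite dual_scaleD (Fs _ ys) mulr0 addr0.
by rewrite phil phi0 addr0 mulVf// -ball_normE /= sub0r normrN normr1 ltxx.
Qed.

Lemma weak_continuous_functional X (f : dual X) :
  continuous (f : weak X -> K^o).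
Proof.
move=> x V; rewrite nbhs_simpl /= => Vfx.
have /cvg_sup/(_ f) : nbhs (x : weak X) --> (x : weak X) by [].
by apply; exact: (@initial_continuous (weak X) K^o f x V).
Qed.

Lemma evaluation_bounded_linear X (x : X) :
  bounded_linear (fun f : dual X => f x : K^o).
Proof.
split; first by move=> a f g.
by exists `|x| => f; rewrite mulrC; exact: opnormP.
Qed.

Definition canonical_embedding X (x : X) : dual (dual X) :=
  mk_blin (evaluation_bounded_linear X x).

(** The point representing [phi] lies in [dual X], so the restriction of [phi]
    to the canonical image of [X] determines it. *)
Lemma weak_star_continuous_bidual X (phi : dual (dual X) -> K)
    (lambda : dual X) :
  (forall a F G, phi (a *: F + G) = a * phi F + phi G) ->
  continuous (phi : weak_star (dual X) -> K^o) ->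
  (forall x, lambda x = phi (canonical_embedding X x)) ->
  forall F, phi F = F lambda.
Proof.
move=> phil /(weak_star_continuous_evaluation _ _ phil)[mu phiE] lambdaE F.
suff -> : lambda = mu by [].
by apply/val_inj/funext => x /=; rewrite lambdaE phiE.
Qed.

End WeakStarFunctionals.

Section SecondAdjoint.
Context {R : realType} {k : scalar_kind}.
Local Notation K := (scalars R k).
Local Open Scope ring_scope.

Variables (C N : normedModType K) (m : bbilin C C C).
Variables (l : bbilin C N N) (r : bbilin N C N) (D : blin C (dual N)).
Hypothesis derD : is_derivation m (dual_l r) (dual_r l) D.

(** The derivation rule tested against [b] in the bidual of [N]; the two
    summands are [y |-> <b, x D(y)>] and [y |-> <b, D(x) y>]. *)
Lemma star_adjoint_derivation (b : dual (dual N)) (x : C) :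
  star m (adjoint D b) x =
  adjoint D (arens r b (canonical_embedding C x)) + star (star l) b (D x).
Proof.
apply/val_inj/funext => y.
have [bl _] := blinP b; rewrite /= derD -[X in b (X + _)]scale1r bl scale1r.
by congr (b _ + _); apply/val_inj/funext.
Qed.

Lemma second_adjoint_derivation :
  tZl (arens r) = [set: dual (dual N)] ->
  is_derivation (arens m) (dual_l (arens r)) (dual_r (arens l))
    (adjoint (adjoint D)).
Proof.
move=> rcont F G; apply/val_inj/funext => b.
have bcont : tZl (arens r) b by rewrite rcont.
(* F (u - v) is the contribution of x D(y), and F v that of D(x) y; phi F is
   <F D''(G), b>. *)
pose phi (F' : dual (dual C)) : K := G (adjoint D (arens r b F')).
pose u := star (star m) G (adjoint D b).
pose v := adjoint D (arens l G b).
have phiF : phi F = F (-1 *: v + u).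
  apply: weak_star_continuous_bidual.
  - move=> a F1 F2; rewrite /phi bbilin_linearr.
    have [Dl _] := blinP (adjoint D); have [Gl _] := blinP G.
    by rewrite Dl Gl.
  - move=> F'; apply: (@continuous_comp (weak_star (dual C))
      (weak (dual (dual N))) K^o (arens r b) (adjoint (adjoint D) G)).
      exact: bcont.
    exact: weak_continuous_functional.
  - move=> x; rewrite dual_scaleD mulN1r addrC.
    have -> : u x = G (star m (adjoint D b) x) by [].
    rewrite star_adjoint_derivation -[X in G (X + _)]scale1r.
    have [Gl _] := blinP G; rewrite Gl scale1r.
    exact: addrK.
have [Fl _] := blinP F.
transitivity (phi F + F v); last by [].
by rewrite phiF Fl scaleN1r addrAC addNr add0r.
Qed.

End SecondAdjoint.

Theorem mainTheorem7 (R : realType) (k : scalar_kind)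
  (A : banachAlgebra R k) (B : banachBimodule A) (n : nat) (n_even : ~~ odd n)
  (D : blin (iterdual A n) (iterdual B n.+1)) :
  is_derivation_iter B n D ->
  tZl_iter B n = [set: iterdual B n.+2] ->
  is_derivation_iter B n.+2 (adjoint (adjoint D)).
Proof. exact: second_adjoint_derivation. Qed.
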